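(* Let $D$ and $D'$ be Dedekind domains such that $\mathcal{P}(D)$ and $\mathcal{P}(D')$ are isomorphic as partially ordered sets. Then $\operatorname{rk}\mathrm{Cl}(D)=\operatorname{rk}\mathrm{Cl}(D')$.
   Context: A Dedekind domain means a one-dimensional (in particular, not a field) integrally closed Noetherian integral domain. For a Dedekind domain $D$, $\mathcal{P}(D)$ denotes the set of ideals of $D$ of the form $\operatorname{rad}(xD)$ with $x\in D\setminus\{0\}$, partially ordered by containment. $\mathrm{Cl}(D)$ is the class group of $D$: the group of nonzero fractional ideals modulo the subgroup of nonzero principal fractional ideals. The rank $\operatorname{rk} G$ of an abelian group $G$ is the dimension of $G\otimes_{\mathbb{Z}}\mathbb{Q}$ as a $\mathbb{Q}$-vector space, regarded as an element of $\mathbb{N}\cup\{\infty\}$ (with value $\infty$ whenever the dimension is infinite). *)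

(* Defs.v *)
From HB Require Import structures.
From mathcomp Require Import all_boot all_order all_algebra.
From mathcomp Require Import boolp classical_sets.
From mathcomp.multinomials Require Import freeg.

Set Implicit Arguments.
Unset Strict Implicit.
Unset Printing Implicit Defensive.

Import GRing.Theory.

Local Open Scope classical_set_scope.
Local Open Scope ring_scope.

Notation "x %:F" := (FracField.tofrac x) : ring_scope.

Section Ideals.
Variable D : idomainType.
Implicit Types (I P : set D) (x : D).

Definition ideal I : Prop :=
  [/\ I 0, forall a b, I a -> I b -> I (a + b) & forall a b, I b -> I (a * b)].

Definition prime_ideal P : Prop :=
  [/\ ideal P, ~ P 1 & forall a b, P (a * b) -> P a \/ P b].

Definition principal_ideal x : set D := [set y | exists a, y = a * x].

Definition radical I : set D := [set x | exists n, I (x ^+ n)].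

Definition noetherian : Prop :=
  forall I : nat -> set D, (forall n, ideal (I n)) ->
    (forall n, I n `<=` I n.+1) ->
  exists N, forall n, (N <= n)%N -> I n = I N.

Definition prime_chain n (C : nat -> set D) : Prop :=
  (forall i, (i <= n)%N -> prime_ideal (C i)) /\
  (forall i, (i < n)%N -> C i `<` C i.+1).

Definition has_krull_dim n : Prop :=
  (exists C, prime_chain n C) /\ ~ (exists C, prime_chain n.+1 C).

Definition integrally_closed : Prop :=
  forall z : {fraction D},
    integralOver (@FracField.tofrac D) z -> exists a : D, z = a%:F.

End Ideals.

HB.mixin Record isDedekind D of GRing.IntegralDomain D := {
  dedekind_noetherian : noetherian D;
  dedekind_krull_dim1 : has_krull_dim D 1;
  dedekind_integrally_closed : integrally_closed D
}.

#[short(type="dedekindType")]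
HB.structure Definition Dedekind := {D of GRing.IntegralDomain D & isDedekind D}.

(* The underlying set of the poset P(D), ordered by inclusion. *)
Definition principal_radicals (D : idomainType) : set (set D) :=
  [set I | exists2 x : D, x != 0 & I = radical (principal_ideal x)].

Arguments principal_radicals D : clear implicits.

(* As types, P and P' are the subtypes of their elements (coercion set_type). *)
Definition order_isomorphic (T T' : Type) (P : set (set T)) (P' : set (set T')) :
    Prop :=
  exists2 f : P -> P', bijective f &
    forall I J : P, (\val I `<=` \val J) <-> (\val (f I) `<=` \val (f J)).

Section FractionalIdeals.
Variable D : idomainType.
Local Notation K := {fraction D}.
Implicit Types (I J : set K) (x : K).

Definition fractional_ideal I : Prop :=
  [/\ I 0, forall x y, I x -> I y -> I (x + y),
      forall (a : D) x, I x -> I (a%:F * x) &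
      exists2 d : D, d != 0 & forall x, I x -> exists a : D, d%:F * x = a%:F].

Definition nonzero_fractional : set (set K) :=
  [set I | fractional_ideal I /\ exists2 x, x != 0 & I x].

Definition principal_fractional x : set K := [set y | exists a : D, y = a%:F * x].

Definition mul_frac I J : set K :=
  [set x | exists2 s : seq (K * K), (forall p, p \in s -> I p.1 /\ J p.2) &
                                    x = \sum_(p <- s) p.1 * p.2].

Definition inv_frac I : set K :=
  [set x | forall y, I y -> exists a : D, x * y = a%:F].

End FractionalIdeals.

Section Invertibility.

Lemma noetherian_max (D : idomainType) (F : set (set D)) (I0 : set D) :
  noetherian D -> F I0 -> (forall I, F I -> ideal I) ->
  exists2 M, F M & forall J, F J -> M `<=` J -> J = M.
Proof.
move=> noeth FI0 Fid; apply: contrapT => noM.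
have step (I : {I | F I}) :
    {J : {J | F J} | projT1 I `<=` projT1 J /\ projT1 J <> projT1 I}.
  apply: cid; case: I => I FI /=; apply: contrapT => noJ.
  apply: noM; exists I => // J FJ IJ; apply: contrapT => JI.
  by apply: noJ; exists (exist _ J FJ).
pose s n := iter n (fun I => projT1 (step I)) (exist _ I0 FI0).
have sS n : projT1 (s n) `<=` projT1 (s n.+1) /\ projT1 (s n.+1) <> projT1 (s n).
  exact: (projT2 (step (s n))).
have [||N sN] := noeth (fun n => projT1 (s n)).
- by move=> n; apply: Fid; exact: (projT2 (s n)).
- by move=> n; case: (sS n).
- by case: (sS N) => _; apply; exact: (sN N.+1 (leqnSn N)).
Qed.

Lemma krull_dim1_prime_eq (D : idomainType) (P Q : set D) (a : D) :
  has_krull_dim D 1 -> prime_ideal P -> prime_ideal Q -> a != 0 -> P a ->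
  P `<=` Q -> P = Q.
Proof.
move=> [_ no2] pP pQ a0 Pa PQ; apply: contrapT => PneQ; apply: no2.
have p0 : prime_ideal [set (0 : D)].
  split=> [|/eqP|x y /eqP]; last 2 first.
  - by rewrite oner_eq0.
  - by rewrite mulf_eq0 => /orP[]/eqP ->; [left|right].
  split=> // [x y -> ->|x y ->]; rewrite ?addr0 ?mulr0 //.
exists (fun n => match n with 0%N => [set (0 : D)] | 1 => P | _ => Q end).
split=> [[|[|i]]|[|[|i]]] //= _; split=> //.
- by move=> x ->; case: pP => -[].
- by move=> /(_ _ Pa) /eqP; exact/negP.
- by move=> QP; apply: PneQ; rewrite eqEsubset.
Qed.

Variable D : dedekindType.
Local Notation K := {fraction D}.
Implicit Types (I J P : set D) (a b d : D) (z : K).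

Lemma ideal_escape I a :
  ideal I -> a != 0 -> I a -> ~ I 1 ->
  exists2 z, ~ (exists b : D, z = b%:F) &
             forall x, I x -> exists b : D, z * x%:F = b%:F.
Proof.
move=> idI a0 Ia I1; apply: contrapT => noz.
pose F := [set J | [/\ ideal J, (exists2 c, c != 0 & J c), ~ J 1 &
  forall z, (forall x, J x -> exists b, z * x%:F = b%:F) -> exists b, z = b%:F]].
have FI : F I.
  split=> //; first by exists a.
  by move=> z zI; apply: contrapT => nz; apply: noz; exists z.
have [J [idJ _ _ _] //|P [idP [c c0 Pc] P1 Pz] Pmax] :=
  noetherian_max (@dedekind_noetherian D) FI.
have [P0 PD PM] := idP.
have Padd x : ~ P x -> exists p r, P p /\ 1 = p + r * x.
  move=> nPx; pose Q := [set y | exists p r, P p /\ y = p + r * x].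
  have PQ : P `<=` Q by move=> y Py; exists y, 0; rewrite mul0r addr0.
  have idQ : ideal Q.
    split; first exact: PQ.
    - move=> _ _ [p [r [Pp ->]]] [q [s [Pq ->]]]; exists (p + q), (r + s).
      by split; [exact: PD | rewrite mulrDl addrACA].
    - move=> u _ [p [r [Pp ->]]]; exists (u * p), (u * r).
      by split; [exact: PM | rewrite mulrDr mulrA].
  apply: contrapT => nQ1; have QP : Q = P.
    apply: Pmax => //; split=> //; first by exists c => //; exact: PQ.
    by move=> z zQ; apply: Pz => y Py; apply: zQ; exact: PQ.
  by apply: nPx; rewrite -QP; exists 0, 1; rewrite add0r mul1r.
have pP : prime_ideal P.
  split=> // x y Pxy; apply: contrapT => /not_orP[/Padd[p [r [Pp e]]] nPy].
  apply: nPy; have -> : y = y * p + r * (x * y).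
    by rewrite -[LHS]mul1r e mulrDl (mulrC p) mulrA.
  by apply: PD; exact: PM.
pose colon b := [set x | exists u, x * b = u * c].
have idcolon b : ideal (colon b).
  split; first by exists 0; rewrite !mul0r.
  - by move=> x y [u eu] [v ev]; exists (u + v); rewrite !mulrDl eu ev.
  - by move=> x y [u eu]; exists (x * u); rewrite -!mulrA eu.
pose G := [set J | J `<=` P /\ exists b, J = colon b].
have G1 : G (colon 1).
  split; last by exists 1.
  by move=> x [u]; rewrite mulr1 => ->; exact: PM.
have [J [_ [b ->]] //|J [JP [b Jb]] Jmax] :=
  noetherian_max (@dedekind_noetherian D) G1.
have idJ : ideal J by rewrite Jb.
have Jsat s x : ~ P s -> J (s * x) -> J x.
  rewrite {1}Jb => nPs [u eu].
  have <- : colon (s * b) = J.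
    apply: Jmax.
      split; last by exists (s * b).
      move=> r [v ev]; have /JP Prs : J (r * s).
        by rewrite Jb; exists v; rewrite -mulrA.
      by case: pP => _ _ /(_ _ _ Prs)[].
    by rewrite Jb => r [v ev]; exists (s * v); rewrite mulrCA ev mulrA.
  by exists u; rewrite mulrA (mulrC x).
have pJ : prime_ideal J.
  split=> //; first by move=> /JP.
  move=> x y Jxy; apply: contrapT => /not_orP[nJx nJy].
  have JS : J `<=` colon (x * b).
    by rewrite Jb => r [v ev]; exists (x * v); rewrite mulrCA ev mulrA.
  have nsub : ~ (colon (x * b) `<=` P).
    move=> sub; apply: nJy.
    rewrite -(Jmax (colon (x * b)) _ JS); last by split=> //; exists (x * b).
    by move: Jxy; rewrite {1}Jb => -[u eu]; exists u; rewrite mulrA (mulrC y).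
  apply: nsub => s [v ev]; apply: contrapT => nPs; apply: nJx.
  by apply: (Jsat s) => //; rewrite Jb; exists v; rewrite -mulrA.
have Jc : J c by rewrite Jb; exists b; rewrite mulrC.
have JPe := krull_dim1_prime_eq (@dedekind_krull_dim1 D) pJ pP c0 Jc JP.
have cF0 : c%:F != 0 :> K by rewrite tofrac_eq0.
have [|u eu] := Pz (b%:F / c%:F).
  move=> x; rewrite -JPe Jb => -[u eu]; exists u.
  by rewrite mulrAC -rmorphM /= mulrC (mulrC b) eu rmorphM /= mulrCA mulVf // mulr1.
apply: P1; rewrite -JPe Jb; exists u; rewrite mul1r.
by apply/eqP; rewrite -tofrac_eq rmorphM /= -eu mulfVK.
Qed.

Lemma bounded_powers_integral (w z : K) : w != 0 ->
  (forall n, exists a : D, w * z ^+ n = a%:F) -> exists a : D, z = a%:F.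
Proof.
move=> w0 wz; apply: dedekind_integrally_closed.
pose ev (p : {poly D}) : K := (map_poly (@FracField.tofrac D) p).[z].
pose A n := [set r : D | exists2 p : {poly D}, (size p <= n)%N & r%:F = w * ev p].
have [||N AN] := @dedekind_noetherian D A.
- move=> n; split.
  + by exists 0; rewrite ?size_poly0 // /ev map_poly0 horner0 mulr0 tofrac0.
  + move=> x y [p sp ep] [q sq eq]; exists (p + q).
      by rewrite (leq_trans (size_polyD _ _)) // geq_max sp.
    by rewrite rmorphD /= ep eq -mulrDr /ev rmorphD hornerD.
  + move=> x y [p sp ep]; exists (x *: p).
      exact: leq_trans (size_scale_leq _ _) sp.
    by rewrite rmorphM /= ep mulrCA /ev map_polyZ hornerZ.
- by move=> n x [p sp ep]; exists p => //; exact: leqW.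
have [a ea] := wz N.
have : A N.+1 a by exists 'X^N; rewrite ?size_polyXn // /ev map_polyXn hornerXn.
rewrite AN // => -[p sp ep]; exists ('X^N - p).
  rewrite monicE lead_coefDl ?lead_coefXn // size_polyN size_polyXn ltnS //.
apply/rootP; rewrite rmorphB /= map_polyXn hornerD hornerN hornerXn.
by apply: (mulfI w0); rewrite mulr0 mulrBr ea ep subrr.
Qed.

Lemma inv_frac_nonzero_fractional (I : set K) :
  nonzero_fractional I -> nonzero_fractional (inv_frac I).
Proof.
move=> [[I0 ID IM [d d0 dI]] [x x0 Ix]]; split; last first.
  exists d%:F; rewrite ?tofrac_eq0 //.
split.
- by move=> y _; exists 0; rewrite mul0r tofrac0.
- move=> u v Iu Iv y Iy; have [a ea] := Iu y Iy; have [b eb] := Iv y Iy.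
  by exists (a + b); rewrite mulrDl ea eb rmorphD.
- by move=> a u Iu y Iy; have [b eb] := Iu y Iy; exists (a * b); rewrite -mulrA eb rmorphM.
have [a ea] := dI x Ix; exists a.
  by rewrite -tofrac_eq0 -ea mulf_neq0 // tofrac_eq0.
move=> u Iu; have [b eb] := Iu x Ix; exists (d * b).
by rewrite -ea rmorphM /= -eb mulrAC -mulrA.
Qed.

Lemma mul_fracC (I J : set K) : mul_frac I J = mul_frac J I.
Proof.
suff H (I' J' : set K) : mul_frac I' J' `<=` mul_frac J' I' by rewrite eqEsubset.
move=> _ [s sIJ ->]; exists [seq (p.2, p.1) | p <- s].
  by move=> _ /mapP[p /sIJ[? ?] ->].
by rewrite big_map; apply: eq_bigr => p _; rewrite mulrC.
Qed.

Lemma mul_frac_sub (I J M : set K) : fractional_ideal M ->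
  (forall x y, I x -> J y -> M (x * y)) -> mul_frac I J `<=` M.
Proof.
move=> [M0 MD _ _] IJM _ [s sIJ ->]; rewrite big_seq.
by elim/big_ind: _ => // p /sIJ[? ?]; exact: IJM.
Qed.

Lemma mul_frac_mem (I J : set K) x y : I x -> J y -> mul_frac I J (x * y).
Proof.
move=> Ix Jy; exists [:: (x, y)]; last by rewrite big_seq1.
by move=> p; rewrite inE => /eqP ->.
Qed.

Lemma mul_frac_nonzero_fractional (I J : set K) :
  nonzero_fractional I -> nonzero_fractional J ->
  nonzero_fractional (mul_frac I J).
Proof.
move=> [[I0 ID IM [d d0 dI]] [x x0 Ix]] [[J0 JD JM [e e0 eJ]] [y y0 Jy]].
split; last by exists (x * y); [rewrite mulf_neq0 | exact: mul_frac_mem].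
split.
- by exists [::] => //; rewrite big_nil.
- move=> _ _ [s sIJ ->] [t tIJ ->]; exists (s ++ t); last by rewrite big_cat.
  by move=> p; rewrite mem_cat => /orP[/sIJ|/tIJ].
- move=> a _ [s sIJ ->]; exists [seq (a%:F * p.1, p.2) | p <- s].
    by move=> _ /mapP[p /sIJ[? ?] ->]; split=> //; exact: IM.
  by rewrite big_map mulr_sumr; apply: eq_bigr => p _; rewrite mulrA.
exists (d * e) => [|_ [s sIJ ->]]; first by rewrite mulf_neq0.
rewrite big_seq; elim/big_ind: _ => [|u v [a ea] [b eb]|p /sIJ[Ip Jp]].
- by exists 0; rewrite mulr0 tofrac0.
- by exists (a + b); rewrite mulrDr ea eb rmorphD.
have [a ea] := dI _ Ip; have [b eb] := eJ _ Jp; exists (a * b).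
by rewrite !rmorphM /= -ea -eb mulrACA.
Qed.

Lemma principal_nonzero_fractional z :
  z != 0 -> nonzero_fractional (principal_fractional z).
Proof.
move=> z0; split; last by exists z => //; exists 1; rewrite tofrac1 mul1r.
split.
- by exists 0; rewrite tofrac0 mul0r.
- by move=> _ _ [a ->] [b ->]; exists (a + b); rewrite rmorphD mulrDl.
- by move=> a _ [b ->]; exists (a * b); rewrite rmorphM mulrA.
have [n [d [d0 e]]] : exists n d : D, d != 0 /\ z * d%:F = n%:F.
  elim/quotW: z {z0} => r.
  exists (frac r).1, (frac r).2; split; first exact: denom_ratioP.
  have d0 := denom_ratioP r.
  unlock FracField.tofrac; rewrite !piE; apply/eqP.
  rewrite piE /= FracField.equivfE /FracField.mulf.
  by rewrite !numden_Ratio ?mulf_neq0 ?oner_neq0 // !mulr1 mulrC.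
exists d => // _ [b ->]; exists (b * n).
by rewrite rmorphM /= -e mulrCA (mulrC d%:F).
Qed.

Lemma mul_fracA (I J M : set K) :
    nonzero_fractional I -> nonzero_fractional J -> nonzero_fractional M ->
  mul_frac I (mul_frac J M) = mul_frac (mul_frac I J) M.
Proof.
suff H (A B C : set K) : nonzero_fractional A -> nonzero_fractional B ->
    nonzero_fractional C ->
    mul_frac A (mul_frac B C) `<=` mul_frac (mul_frac A B) C.
  move=> nI nJ nM; rewrite eqEsubset; split; first exact: H.
  rewrite (mul_fracC (mul_frac I J)) (mul_fracC I J) (mul_fracC I).
  by rewrite (mul_fracC J M); apply: H.
move=> nA nB nC; have [|fABC _] := @mul_frac_nonzero_fractional (mul_frac A B) C _ nC.
  exact: mul_frac_nonzero_fractional.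
apply: mul_frac_sub => // x _ Ax [s sBC ->]; rewrite mulr_sumr big_seq.
have [X0 XD _ _] := fABC; elim/big_ind: _ => // p /sBC[Bp Cp].
by rewrite mulrA; apply: mul_frac_mem => //; exact: mul_frac_mem.
Qed.

Lemma mul_frac1 (I : set K) : nonzero_fractional I ->
  mul_frac (principal_fractional 1) I = I.
Proof.
move=> [fI _]; rewrite eqEsubset; split.
  apply: mul_frac_sub => // _ y [a ->] Iy; rewrite mulr1.
  by case: fI => _ _ + _; apply.
move=> x Ix; rewrite -[x]mul1r; apply: mul_frac_mem => //.
by exists 1; rewrite tofrac1 mulr1.
Qed.

Lemma mul_fracV (I : set K) : nonzero_fractional I ->
  mul_frac (inv_frac I) I = principal_fractional 1.
Proof.
move=> nI; have nV := inv_frac_nonzero_fractional nI.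
have [fJ [j j0 Jj]] := mul_frac_nonzero_fractional nV nI.
have [f1 _] := @principal_nonzero_fractional 1 (oner_neq0 _).
have J1 : mul_frac (inv_frac I) I `<=` principal_fractional 1.
  apply: mul_frac_sub => // x y Vx Iy; have [a ->] := Vx y Iy.
  by exists a; rewrite mulr1.
rewrite eqEsubset; split=> //; have [J0 JD JM _] := fJ.
suff J1' : mul_frac (inv_frac I) I 1 by move=> _ [a ->]; exact: JM.
apply: contrapT => nJ1.
pose J := [set a : D | mul_frac (inv_frac I) I a%:F].
have idJ : ideal J.
  split; rewrite /J /= ?tofrac0 // => a b; first by rewrite rmorphD; exact: JD.
  by rewrite rmorphM; exact: JM.
have [b jb] := J1 _ Jj; rewrite mulr1 in jb.
have b0 : b != 0 by rewrite -tofrac_eq0 -jb.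
have [||z nz zJ] := ideal_escape idJ b0; rewrite /J /= -?jb ?tofrac1 //.
have [fV [v v0 Vv]] := nV; have [_ [x x0 Ix]] := nI.
apply: nz; apply: (@bounded_powers_integral (v * x)); first by rewrite mulf_neq0.
have zV u : inv_frac I u -> inv_frac I (z * u).
  move=> Vu y Iy; have uyJ := mul_frac_mem Vu Iy.
  have [a ea] := Vu y Iy; rewrite -mulrA ea; apply: zJ.
  by rewrite /J /= -ea.
move=> n; suff Vzn : inv_frac I (z ^+ n * v).
  by have [a ea] := Vzn x Ix; exists a; rewrite -ea mulrC mulrA.
by elim: n => [|n IH]; rewrite ?expr0 ?mul1r // exprS -mulrA; exact: zV.
Qed.

End Invertibility.

(* The group of nonzero fractional ideals. It is written additively, so that
   zmodType applies: I + J is the product ideal, 0 is D and - I is (D : I).   *)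
Definition frac_ideals (D : dedekindType) : Type := @nonzero_fractional D.

Section FracIdealsGroup.
Variable D : dedekindType.
Implicit Types I J M : frac_ideals D.

HB.instance Definition _ :=
  Choice.copy (frac_ideals D) (set_type (@nonzero_fractional D)).

Definition FracIdeal (I : set {fraction D}) (nI : nonzero_fractional I) :
    frac_ideals D :=
  exist (fun J : set {fraction D} => J \in @nonzero_fractional D) I (mem_set nI).

Definition frac_ideals_zero : frac_ideals D :=
  FracIdeal (principal_nonzero_fractional (oner_neq0 {fraction D})).

Definition frac_ideals_add I J : frac_ideals D :=
  FracIdeal (mul_frac_nonzero_fractional (set_valP I) (set_valP J)).

Definition frac_ideals_opp I : frac_ideals D :=
  FracIdeal (inv_frac_nonzero_fractional (set_valP I)).

Lemma frac_ideals_addA : associative frac_ideals_add.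
Proof. by move=> I J M; apply: val_inj; apply: mul_fracA; exact: set_valP. Qed.

Lemma frac_ideals_addC : commutative frac_ideals_add.
Proof. by move=> I J; apply: val_inj; exact: mul_fracC. Qed.

Lemma frac_ideals_add0 : left_id frac_ideals_zero frac_ideals_add.
Proof. by move=> I; apply: val_inj; apply: mul_frac1; exact: set_valP. Qed.

Lemma frac_ideals_addN :
  left_inverse frac_ideals_zero frac_ideals_opp frac_ideals_add.
Proof. by move=> I; apply: val_inj; apply: mul_fracV; exact: set_valP. Qed.

HB.instance Definition _ := GRing.isZmodule.Build (frac_ideals D)
  frac_ideals_addA frac_ideals_addC frac_ideals_add0 frac_ideals_addN.

Definition principal_ideals : {pred frac_ideals D} :=
  fun I => `[< exists2 x, x != 0 & \val I = principal_fractional x >].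

Lemma principal_ideals_closed : zmod_closed principal_ideals.
Proof.
have mulP x y : mul_frac (principal_fractional x) (principal_fractional y)
    = principal_fractional (x * y) :> set {fraction D}.
  rewrite eqEsubset; split=> [_ [s sxy ->]|_ [a ->]]; last first.
    rewrite mulrA; apply: mul_frac_mem; first by exists a.
    by exists 1; rewrite tofrac1 mul1r.
  rewrite big_seq; elim/big_ind: _ => [|_ _ [a ->] [b ->]|p].
  - by exists 0; rewrite tofrac0 mul0r.
  - by exists (a + b); rewrite rmorphD mulrDl.
  - by move=> /sxy[[a ->] [b ->]]; exists (a * b); rewrite rmorphM /= mulrACA.
split; first by apply/asboolP; exists 1; rewrite ?oner_neq0.
move=> I J /asboolP[x x0 Ix] /asboolP[y y0 Jy]; apply/asboolP.
have yV0 : y^-1 != 0 by rewrite invr_eq0.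
exists (x / y); first by rewrite mulf_neq0.
pose N := FracIdeal (principal_nonzero_fractional yV0).
have -> : - J = N.
  apply: (addrI J); rewrite subrr; apply: val_inj.
  by rewrite /= [X in mul_frac X _]Jy mulP divff.
by rewrite /= -mulP -Ix.
Qed.

HB.instance Definition _ :=
  GRing.isZmodClosed.Build (frac_ideals D) principal_ideals
    principal_ideals_closed.

End FracIdealsGroup.

Definition Cl (D : dedekindType) : zmodType :=
  Quotient.quot (@principal_ideals D).

(* A (x)_Z B is the free abelian group on A * B modulo the subgroup generated
   by the bilinearity relations.                                              *)
Section TensorProduct.
Variable A : zmodType.

Section Group.
Variable B : zmodType.

Definition pure (a : A) (b : B) : {freeg (A * B)} := Freeg [:: (1, (a, b))].

Inductive tensor_rel : {freeg (A * B)} -> Prop :=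
| tensor_rel0 : tensor_rel 0
| tensor_relB x y : tensor_rel x -> tensor_rel y -> tensor_rel (x - y)
| tensor_rel_addl a a' b :
    tensor_rel (pure (a + a') b - (pure a b + pure a' b))
| tensor_rel_addr a b b' :
    tensor_rel (pure a (b + b') - (pure a b + pure a b')).

Definition tensor_relations : {pred {freeg (A * B)}} :=
  fun x => `[< tensor_rel x >].

Lemma tensor_relations_closed : zmod_closed tensor_relations.
Proof.
split; first by apply/asboolP; exact: tensor_rel0.
by move=> x y /asboolP ? /asboolP ?; apply/asboolP; exact: tensor_relB.
Qed.

HB.instance Definition _ :=
  GRing.isZmodClosed.Build {freeg (A * B)} tensor_relations
    tensor_relations_closed.

Definition tensor : Type := Quotient.quot tensor_relations.

HB.instance Definition _ := GRing.Zmodule.on tensor.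
HB.instance Definition _ := ring_quotient.ZmodQuotient.on tensor.

End Group.

(* If B is an R-module, so is A (x)_Z B, with r (a (x) b) = a (x) (r b).      *)
Section Module.
Variables (R : nzRingType) (B : lmodType R).
Local Open Scope quotient_scope.
Local Notation F := {freeg (A * B)}.
Implicit Types (r s : R) (x y : F).

Definition free_scale r : F -> F :=
  fglift (fun p : A * B => pure p.1 (r *: p.2)).

Definition tensor_scale r (u : tensor B) : tensor B :=
  \pi_(tensor B) (free_scale r (repr u)).

Fact free_scale_is_zmod_morphism r : zmod_morphism (free_scale r).
Proof. exact: lift_is_additive. Qed.

HB.instance Definition _ r :=
  GRing.isZmodMorphism.Build F F (free_scale r) (free_scale_is_zmod_morphism r).

Lemma free_scaleE r a b : free_scale r (pure a b) = pure a (r *: b).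
Proof. by rewrite /free_scale liftU scale1r. Qed.

Lemma free_ind (P : F -> Prop) : P 0 -> (forall x y, P x -> P y -> P (x - y)) ->
  (forall a b, P (pure a b)) -> forall x, P x.
Proof.
move=> P0 PB Pp; have PN x : P x -> P (- x) by rewrite -sub0r; exact: PB.
have PD x y : P x -> P y -> P (x + y).
  by move=> Px Py; rewrite -[y]opprK; apply: PB => //; exact: PN.
have PM x n : P x -> P (x *+ n).
  by move=> Px; elim: n => [|n IH]; rewrite ?mulr0n // mulrS; exact: PD.
apply: freeg_ind_dom0 => // k [a b] x _ _ Px; apply: PD => //.
have -> : Freeg [:: (k, (a, b))] = pure a b *~ k.
  by rewrite freegU_mulz intz.
by case: k => n; [exact: PM | apply: PN; exact: PM].
Qed.

Lemma tensor_rel_scale r x : tensor_rel x -> tensor_rel (free_scale r x).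
Proof.
elim=> [|u v _ IHu _ IHv|a a' b|a b b'].
- by rewrite raddf0; exact: tensor_rel0.
- by rewrite raddfB; exact: tensor_relB.
- by rewrite raddfB raddfD /= !free_scaleE; exact: tensor_rel_addl.
- rewrite raddfB raddfD /= !free_scaleE scalerDr; exact: tensor_rel_addr.
Qed.

Lemma pi_tensorP x y :
  \pi_(tensor B) x = \pi_(tensor B) y <-> tensor_rel (x - y).
Proof.
split=> [/eqP|xy]; last apply/eqP.
  by rewrite -Quotient.idealrBE => /asboolP.
by rewrite -Quotient.idealrBE; exact/asboolP.
Qed.

Lemma tensor_scale_pi r x :
  tensor_scale r (\pi_(tensor B) x) = \pi_(tensor B) (free_scale r x).
Proof.
apply/pi_tensorP; rewrite -raddfB; apply: tensor_rel_scale.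
by apply/pi_tensorP; rewrite reprK.
Qed.

Lemma tensor_scaleA r s u : tensor_scale r (tensor_scale s u) =
  tensor_scale (r * s) u.
Proof.
elim/quotW: u => x.
rewrite (tensor_scale_pi s x) !tensor_scale_pi; congr pi.
elim/free_ind: x => [|x y IHx IHy|a b]; first by rewrite !raddf0.
  by rewrite !raddfB /= IHx IHy.
by rewrite !free_scaleE scalerA.
Qed.

Lemma tensor_scale1 : left_id 1 tensor_scale.
Proof.
elim/quotW => x; rewrite tensor_scale_pi; congr pi.
elim/free_ind: x => [|x y IHx IHy|a b]; first by rewrite !raddf0.
  by rewrite !raddfB /= IHx IHy.
by rewrite !free_scaleE scale1r.
Qed.

Lemma tensor_scaleDr : right_distributive tensor_scale +%R.
Proof.
move=> r; elim/quotW => x; elim/quotW => y.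
by rewrite -raddfD !tensor_scale_pi !raddfD.
Qed.

Lemma tensor_scaleDl u : {morph tensor_scale^~ u : r s / r + s}.
Proof.
move=> r s; elim/quotW: u => x; rewrite !tensor_scale_pi -raddfD.
apply/pi_tensorP.
elim/free_ind: x => [|x y IHx IHy|a b].
- by rewrite !raddf0 addr0 subrr; exact: tensor_rel0.
- have swap (a b c d : F) : a - b - (c - d) = a - c - (b - d).
    by rewrite !opprB addrACA [RHS]addrACA (addrC (- b)).
  by rewrite !raddfB /= (addrACA (free_scale r x)) -opprD swap; exact: tensor_relB.
- by rewrite !free_scaleE scalerDl; exact: tensor_rel_addr.
Qed.

HB.instance Definition _ := GRing.Zmodule_isLmodule.Build R (tensor B)
  tensor_scaleA tensor_scale1 tensor_scaleDr tensor_scaleDl.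

End Module.
End TensorProduct.

Definition is_basis (F : fieldType) (V : lmodType F) n (v : 'I_n -> V) : Prop :=
  (forall c : 'I_n -> F, \sum_i c i *: v i = 0 -> forall i, c i = 0) /\
  (forall x : V, exists c : 'I_n -> F, x = \sum_i c i *: v i).

(* Dimension in N u {oo}: None stands for oo.                                 *)
Definition dimension (F : fieldType) (V : lmodType F) : option nat :=
  match pselect (exists n, exists v : 'I_n -> V, is_basis v) with
  | left h => Some (projT1 (cid h))
  | right _ => None
  end.

Definition rk (G : zmodType) : option nat := dimension (tensor G rat^o).

(* Main.v *)
From HB Require Import structures.
From mathcomp Require Import boolp classical_sets.
From mathcomp.multinomials Require Import freeg.
From mathcomp Require Import all_boot all_order all_algebra.
Require Import Defs.

(** Write X for the set of nonzero primes of D, V(x) for the finite set of the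
    primes that contain x != 0, and [P] for the class of P. Unique factorization
    gives rad(xD) <= rad(yD) iff V(y) is contained in V(x), so P(D) is, with the
    order reversed, the family S of the sets V(x), which is closed under unions.

    The order on S determines X and the membership relation between X and S.
    Indeed the maximal proper ideals of S (nonempty, closed downwards and under
    unions) are the sets {S | P notin S}, because distinct primes are
    incomparable and so the members of S that avoid P cover X minus P. Hence an
    isomorphism P(D) = P(D') comes from a bijection of X with X' that carries S
    onto S' ([matching_exists], [principal_locus_transfer]).

    It remains to read the rank of Cl(D) off S. The classes [P] span the rational
    vector space Cl(D) (x) Q, and a finite set B of primes is in S iff some
    relation sum_P w_P [P] = 0 in it has w_P > 0 on B and w_P = 0 off B: clear
    denominators and torsion to get a principal product of powers of exactly the
    primes in B ([positive_relation_tens], [prime_relation_principal]). Fix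
    B = V(x) with m elements and let W be the space of all relations between
    the classes of its primes; these classes have rank m - dim W. The members
    of S contained in B are the supports of the nonnegative vectors of W, that
    is, they form the face lattice of the polyhedral cone of such vectors. As
    B itself is a support, this cone spans W, and the height of a face lattice
    is the dimension of the cone. So dim W is determined by S
    ([eq_dim_positive_supports]), and therefore so is the rank of the classes
    of the primes in V(x). Every finite set of vectors of Cl(D) (x) Q is in the
    span of the classes of the primes in V(x) for some x, hence S determines
    for which n there are n independent vectors in Cl(D) (x) Q. *)

Set Implicit Arguments.
Unset Strict Implicit.
Unset Printing Implicit Defensive.

Import Order.TTheory GRing.Theory Num.Theory.

Local Open Scope classical_set_scope.
Local Open Scope ring_scope.

(** * Dimension and independent families *)

Definition independent (F : fieldType) (V : lmodType F) n (v : 'I_n -> V) :=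
  forall c : 'I_n -> F, \sum_i c i *: v i = 0 -> forall i, c i = 0.

Section Dimension.
Variable F : fieldType.

Lemma independent_le_basis (V : lmodType F) m n (v : 'I_m -> V) (b : 'I_n -> V) :
  independent v -> is_basis b -> (m <= n)%N.
Proof.
move=> iv [_ spanb]; rewrite leqNgt; apply/negP => ltnm.
have [M Mv] := choice (fun i => spanb (v i)).
pose A : 'M[F]_(m, n) := \matrix_(i, j) M i j.
have : (0 < \rank (kermx A))%N.
  by rewrite mxrank_ker subn_gt0 (leq_ltn_trans (rank_leq_col A)).
rewrite lt0n mxrank_eq0 => /rowV0Pn[c /sub_kermxP cA /rV0Pn[i] /eqP]; apply.
apply: (iv (c 0)) => {i}.
under eq_bigr => i _ do rewrite Mv scaler_sumr.
rewrite exchange_big big1 // => j _.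
under eq_bigr => i _ do rewrite scalerA.
have -> : \sum_i (c 0 i * M i j) *: b j = (c *m A) 0 j *: b j.
  by rewrite -scaler_suml mxE; congr (_ *: _); apply: eq_bigr => i _; rewrite mxE.
by rewrite cA mxE scale0r.
Qed.

(** This replaces bases by independent families, whose existence is easier to
    carry from one space to another: a maximal independent family is a basis. *)
Lemma has_basisP (V : lmodType F) n :
  (exists v : 'I_n -> V, is_basis v) <->
  (exists v : 'I_n -> V, independent v) /\
    ~ (exists v : 'I_n.+1 -> V, independent v).
Proof.
split=> [[b bb]|[[v iv] nv]].
  split; first by exists b; case: bb.
  by move=> [v /independent_le_basis/(_ bb)]; rewrite ltnn.
exists v; split=> // x.
pose vx (i : 'I_n.+1) := oapp v x (unlift ord_max i).
have sumE c : \sum_i c i *: vx i =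
    \sum_i c (lift ord_max i) *: v i + c ord_max *: x.
  rewrite (bigD1_ord ord_max) //= /vx unlift_none addrC; congr (_ + _).
  by apply: eq_bigr => i _; rewrite liftK.
have [c] : exists c : 'I_n.+1 -> F,
    \sum_i c i *: vx i = 0 /\ ~ (forall i, c i = 0).
  apply: contrapT => noc; apply: nv; exists vx => c c0.
  by apply: contrapT => nc; apply: noc; exists c.
rewrite sumE => -[c0 nc].
have cmax : c ord_max != 0.
  apply/eqP => cmax; apply: nc => i; case: (unliftP ord_max i) => [j|] -> //.
  by apply: (iv (c \o lift ord_max)); move: c0; rewrite cmax scale0r addr0.
exists (fun i => - (c ord_max)^-1 * c (lift ord_max i)).
under eq_bigr => i _ do rewrite -scalerA.
rewrite -scaler_sumr; apply: (scalerI cmax).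
by rewrite scalerA mulrN divff // scaleN1r; apply/eqP; rewrite -addr_eq0 addrC c0.
Qed.

(** The two dimensions may be infinite, so this does not ask for a common
    basis size: a space has dimension oo iff it has independent families of
    every size. *)
Lemma eq_dimension (V V' : lmodType F) :
  (forall n, (exists v : 'I_n -> V, independent v) <->
             (exists v : 'I_n -> V', independent v)) ->
  dimension V = dimension V'.
Proof.
move=> VV'.
have basE n : (exists v : 'I_n -> V, is_basis v) <->
              (exists v : 'I_n -> V', is_basis v).
  by rewrite !has_basisP !VV'.
rewrite /dimension; case: pselect => [h|nh]; case: pselect => [h'|nh'] //.
- case: (cid h) (cid h') => /= n /basE[b bb] [n' [b' bb']] /=.
  have [ib _] := bb; have [ib' _] := bb'; congr Some; apply/eqP.
  by rewrite eqn_leq (independent_le_basis ib bb') (independent_le_basis ib' bb).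
- by case: nh'; case: h => n /basE; exists n.
- by case: nh; case: h' => n /basE; exists n.
Qed.

End Dimension.

(** * Supports of the nonnegative vectors of a subspace *)

Section Cone.
Variables (F : realFieldType) (m : nat).
Implicit Types (W : {vspace 'rV[F]_m}) (B C : {set 'I_m}) (w : 'rV[F]_m).

Definition positive_on B w := [forall i, if i \in B then 0 < w 0 i else w 0 i == 0].

(** The supports [B] of the nonnegative vectors of [W] correspond to the faces of
    the cone of these vectors; [face W B] below is the space that the face spans
    when [B] is such a support. *)
Definition positive_support W B : Prop := exists2 w, w \in W & positive_on B w.

Definition off_coords B : 'End('rV[F]_m) :=
  linfun (mulmxr (diag_mx (\row_i (i \notin B)%:R))).

Definition face W B : {vspace 'rV[F]_m} := (W :&: lker (off_coords B))%VS.

Lemma mem_face W B w :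
  reflect (w \in W /\ forall i, i \notin B -> w 0 i = 0) (w \in face W B).
Proof.
rewrite memv_cap; apply: (iffP andP) => -[wW].
  rewrite memv_ker lfunE /= => /eqP/rowP w0; split=> // i iB.
  by have := w0 i; rewrite mul_mx_diag !mxE iB mulr1.
move=> w0; split=> //; rewrite memv_ker lfunE /=; apply/eqP/rowP => i.
rewrite mul_mx_diag !mxE; case: (boolP (i \in B)) => iB; first by rewrite mulr0.
by rewrite w0 ?mul0r.
Qed.

Lemma positive_support0 W : positive_support W set0.
Proof. by exists 0; rewrite ?mem0v //; apply/forallP => i; rewrite inE mxE. Qed.

(** This is the fact that a facet of a cone has codimension one. Let [w] be
    positive on [B], and take [u] in [face W B]. Subtract from [u] the multiple
    of [w] given by the least ratio [u i / w i] over [i] in [B] minus [B']: the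
    result [z] is nonnegative there and vanishes at one of these [i]. If [z] were
    nonzero somewhere on [B] minus [B'], adding a large multiple of a vector
    positive on [B'] would give a support strictly between [B'] and [B]. So [z]
    is in [face W B'], and [w] spans [face W B] modulo [face W B']. *)
Lemma dim_face_maximal W B B' :
  positive_support W B -> positive_support W B' -> B' \proper B ->
  (forall C, positive_support W C -> B' \subset C -> C \proper B -> C = B') ->
  \dim (face W B) = (\dim (face W B')).+1.
Proof.
move=> [w wW /forallP wB] [w' w'W /forallP wB'] /properP[sB'B [j jB jB']] maxB'.
have wF : w \in face W B.
  by apply/mem_face; split=> // i iB; apply/eqP; have := wB i; rewrite (negPf iB).
have wNF : w \notin face W B'.
  apply/negP => /mem_face[_ /(_ _ jB') wj].
  by have := wB j; rewrite jB wj ltxx.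
have subF : (face W B' <= face W B)%VS.
  apply/subvP => z /mem_face[zW z0]; apply/mem_face; split=> // i iB.
  by apply: z0; apply: contra iB; exact: (subsetP sB'B).
have -> : face W B = (face W B' + <[w]>)%VS.
  apply/eqP; rewrite eqEsubv subv_add subF -memvE wF !andbT.
  apply/subvP => u uF; have [uW u0] := mem_face _ _ _ uF.
  have jBB' : j \in B :\: B' by rewrite inE jB' jB.
  have [i0 /setDP[i0B i0B'] mini0] :=
    @arg_minP _ _ _ j (fun i => i \in B :\: B') (fun i => u 0 i / w 0 i) jBB'.
  pose t := u 0 i0 / w 0 i0; pose z := u - t *: w.
  have zF : z \in face W B by rewrite memvB // memvZ.
  have [zW z0] := mem_face _ _ _ zF.
  have w_gt0 i : i \in B -> 0 < w 0 i by move=> iB; have := wB i; rewrite iB.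
  have w'_gt0 i : i \in B' -> 0 < w' 0 i by move=> iB; have := wB' i; rewrite iB.
  have w'_0 i : i \notin B' -> w' 0 i = 0.
    by move=> /negPf iB; have := wB' i; rewrite iB => /eqP.
  have z_ge0 i : i \in B :\: B' -> 0 <= z 0 i.
    move=> iBB'; rewrite !mxE subr_ge0 -ler_pdivlMr ?mini0 //.
    by apply: w_gt0; case/setDP: iBB'.
  have zi0 : z 0 i0 = 0 by rewrite !mxE mulfVK ?subrr // gt_eqF ?w_gt0.
  (* A coefficient large enough to make z + N *: w' positive on B'. *)
  pose N := 1 + \sum_(i in B') `|z 0 i| / w' 0 i.
  have N_gt i : i \in B' -> - z 0 i < N * w' 0 i.
    move=> iB'; rewrite -ltr_pdivrMr ?w'_gt0 //.
    apply: (@le_lt_trans _ _ (\sum_(k in B') `|z 0 k| / w' 0 k)); last first.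
      by rewrite ltrDr ltr01.
    rewrite (bigD1 i) //= -[leLHS]addr0 lerD //.
      by rewrite ler_pM2r ?invr_gt0 ?w'_gt0 // -normrN ler_norm.
    by rewrite sumr_ge0 // => k /andP[kB' _]; rewrite divr_ge0 ?normr_ge0 // ltW ?w'_gt0.
  pose C := B' :|: [set i in B | z 0 i != 0].
  have CB' : C = B'.
    apply: maxB'; last 2 first.
    - exact: subsetUl.
    - apply/properP; split; last first.
        by exists i0 => //; rewrite !inE negb_or i0B' zi0 eqxx andbF.
      by apply/subsetP => i; rewrite !inE => /orP[/(subsetP sB'B)|/andP[]].
    exists (z + N *: w'); first by rewrite memvD ?memvZ.
    apply/forallP => i; rewrite !inE.
    have -> : (z + N *: w') 0 i = z 0 i + N * w' 0 i by rewrite [LHS]mxE [X in _ + X]mxE.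
    case: (boolP (i \in B')) => iB' /=; first by rewrite -ltrBlDl sub0r N_gt.
    rewrite w'_0 // mulr0 addr0.
    case: (boolP (i \in B)) => iB /=; last by rewrite z0.
    have := z_ge0 i; rewrite inE iB iB' => /(_ isT).
    by case: eqVneq => [-> //|zn0]; rewrite lt_def zn0.
  rewrite -(subrK (t *: w) u) memv_add ?memvZ ?memv_line //.
  apply/mem_face; split=> // i iB'.
  case: (boolP (i \in B)) => [iB|/z0 //].
  by apply/eqP; apply: contraNT iB' => zn0; rewrite -CB' !inE iB zn0 orbT.
rewrite dimv_disjoint_sum ?dim_vline.
  by case: eqVneq wNF => [->|_ _]; rewrite ?mem0v ?addn1.
apply/eqP; rewrite -subv0; apply/subvP => z; rewrite memv_cap => /andP[zF /vlineP[k zk]].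
rewrite memv0 zk; case: (eqVneq k 0) => [->|k0]; first by rewrite scale0r.
case/negP: wNF; suff -> : w = k^-1 *: z by rewrite memvZ.
by rewrite zk scalerA mulVf // scale1r.
Qed.

(** By induction on [#|B|]: a maximal support strictly below [B] is the same set
    for [W] and for [W'], and passing to it lowers both dimensions by one. *)
Lemma eq_dim_face W W' :
  (forall B, positive_support W B <-> positive_support W' B) ->
  forall B, positive_support W B -> \dim (face W B) = \dim (face W' B).
Proof.
move=> WW' B; have [n] := ubnP #|B|; elim: n B => // n IH B leBn WB.
have [->|B0] := eqVneq B set0.
  have face0 U : face U set0 = 0%VS.
    apply/eqP; rewrite -subv0; apply/subvP => w /mem_face[_ w0].
    by rewrite memv0; apply/eqP/rowP => i; rewrite mxE w0 ?inE.
  by rewrite !face0.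
have P0 : `[< positive_support W set0 >] && (set0 \proper B).
  by rewrite (asboolT (positive_support0 W)) proper0.
have [B' /andP[/asboolP WB' pB'] maxB'] := @arg_maxnP _ set0
  (fun C => `[< positive_support W C >] && (C \proper B)) (fun C => #|C|) P0.
have maxW C : positive_support W C -> B' \subset C -> C \proper B -> C = B'.
  move=> WC sB'C pC; apply/esym/eqP; rewrite eqEcard sB'C.
  by apply: maxB'; rewrite (asboolT WC).
rewrite (@dim_face_maximal W B B') // (@dim_face_maximal W' B B') -?WW' //.
  by rewrite (IH B') // (leq_trans (proper_card pB')).
by move=> C /WW'; exact: maxW.
Qed.

Lemma eq_dim_positive_supports W W' :
  (forall B, positive_support W B <-> positive_support W' B) ->
  positive_support W setT -> \dim W = \dim W'.
Proof.
move=> WW' WT; have faceT U : face U setT = U.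
  by apply/vspaceP => w; apply/mem_face/idP => [[] //|wU]; split=> // i; rewrite inE.
by rewrite -(faceT W) -(faceT W'); exact: eq_dim_face.
Qed.

End Cone.

(** * Rank and the supports of positive relations *)

(** A subspace given by a predicate on a finite-dimensional space is the largest
    among the bundled subspaces that it contains. *)
Lemma vspace_of_closed (F : fieldType) (vT : vectType F) (P : vT -> Prop) :
    P 0 -> (forall a x y, P x -> P y -> P (a *: x + y)) ->
  exists U : {vspace vT}, forall x, x \in U <-> P x.
Proof.
move=> P0 PL; pose Q n := `[< exists2 U : {vspace vT},
  forall x, x \in U -> P x & \dim U = n >].
have exQ : exists n, Q n.
  by exists 0%N; apply/asboolP; exists 0%VS; rewrite ?dimv0 // => x; rewrite memv0 => /eqP ->.
have ubQ n : Q n -> (n <= \dim {:vT})%N by move=> /asboolP[U _ <-]; exact: dimvS (subvf U).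
have [_ /asboolP[U UP <-] maxU] := ex_maxnP exQ ubQ.
exists U => x; split=> [/UP //|Px].
have UxP y : y \in (U + <[x]>)%VS -> P y.
  by move=> /memv_addP[a /UP Pa [_ /vlineP[k ->] ->]]; rewrite addrC; exact: PL.
have /maxU le : Q (\dim (U + <[x]>)) by apply/asboolP; exists (U + <[x]>)%VS.
have /eqP -> : U == (U + <[x]>)%VS by rewrite eqEdim addvSl.
by rewrite -{1}[x]add0r memv_add ?mem0v ?memv_line.
Qed.

Section Relations.
Variables (F : realFieldType) (m : nat).

Definition spans (V : lmodType F) (u : 'I_m -> V) (x : V) : Prop :=
  exists c : 'I_m -> F, x = \sum_i c i *: u i.

Definition positive_relation (V : lmodType F) (u : 'I_m -> V) (B : {set 'I_m}) :=
  exists2 w : 'rV[F]_m, \sum_i w 0 i *: u i = 0 & positive_on B w.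

Lemma relation_space (V : lmodType F) (u : 'I_m -> V) :
  exists W : {vspace 'rV[F]_m}, forall w, w \in W <-> \sum_i w 0 i *: u i = 0.
Proof.
apply: vspace_of_closed => [|a x y x0 y0].
  by rewrite big1 // => i _; rewrite mxE scale0r.
under eq_bigr => i _ do rewrite !mxE scalerDl -scalerA.
by rewrite big_split /= -scaler_sumr x0 y0 scaler0 addr0.
Qed.

(** With [W] the space of relations of [u], this says that [u] has rank
    [m - \dim W]. The coefficient rows of an independent family span a space
    that meets [W] trivially; conversely the rows of a basis of a complement of
    [W] are the coefficients of an independent family. *)
Lemma independent_in_span (V : lmodType F) (u : 'I_m -> V)
    (W : {vspace 'rV[F]_m}) n :
    (forall w, w \in W <-> \sum_i w 0 i *: u i = 0) ->
  (exists2 v : 'I_n -> V, independent v & forall j, spans u (v j)) <->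
  (n + \dim W <= m)%N.
Proof.
move=> relW; have dimT : \dim {:'rV[F]_m} = m by rewrite dimvf /dim /= mul1n.
split=> [[v iv /choice[c vE]]|le_m].
  pose M : 'M[F]_(n, m) := \matrix_(j, i) c j i.
  pose f : 'Hom('rV[F]_n, 'rV[F]_m) := linfun (mulmxr M).
  have fE k : \sum_i f k 0 i *: u i = \sum_j k 0 j *: v j.
    under [RHS]eq_bigr => j _ do rewrite vE scaler_sumr.
    rewrite exchange_big; apply: eq_bigr => i _.
    rewrite lfunE /= mxE scaler_suml; apply: eq_bigr => j _.
    by rewrite mxE scalerA.
  have f0 k : \sum_i f k 0 i *: u i = 0 -> k = 0.
    by rewrite fE => /(iv (k 0)) k0; apply/rowP => j; rewrite mxE k0.
  have kerf : lker f = 0%VS.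
    apply/eqP; rewrite -subv0; apply/subvP => k; rewrite memv_ker memv0 => /eqP fk.
    by apply/eqP/f0; rewrite fk big1 // => i _; rewrite mxE scale0r.
  have dimf : \dim (limg f) = n.
    by rewrite limg_dim_eq ?kerf ?capv0 // dimvf /dim /= mul1n.
  rewrite -[in X in (X + _)%N]dimf -dimv_disjoint_sum -?[leqRHS]dimT ?dimvS ?subvf //.
  apply/eqP; rewrite -subv0; apply/subvP => w; rewrite memv_cap memv0.
  by case/andP => /memv_imgP[k _ ->] /relW /f0 ->; rewrite linear0.
have dimC : \dim W^C%VS = (m - \dim W)%N by rewrite dimv_compl dimT.
have sz : size (take n (vbasis W^C)) == n.
  by rewrite size_takel // size_tuple dimC leq_subRL ?(leq_trans _ le_m) ?leq_addl // addnC.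
pose b := Tuple sz.
have bC (j : 'I_n) : b`_j \in W^C%VS.
  by apply: vbasis_mem; apply: (@mem_take n); rewrite mem_nth ?(eqP sz).
have freeb : free b.
  have := basis_free (vbasisP W^C); rewrite -[X in free X](cat_take_drop n).
  exact: catl_free.
exists (fun j => \sum_i b`_j 0 i *: u i) => [k k0|j]; last by exists (b`_j 0).
move: freeb => /freeP; apply; apply/eqP; rewrite -memv0 -(capv_compl W) memv_cap.
apply/andP; split; last by apply: memv_suml => j _; exact/memvZ/bC.
apply/relW; rewrite -[RHS]k0; under [RHS]eq_bigr => j _ do rewrite scaler_sumr.
rewrite exchange_big; apply: eq_bigr => i _.
by rewrite summxE scaler_suml; apply: eq_bigr => j _; rewrite mxE scalerA.
Qed.

(** The rank of a family of [m] vectors depends only on the supports of its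
    nonnegative relations, provided that some relation is positive everywhere. *)
Lemma independent_transfer (V V' : lmodType F) (u : 'I_m -> V) (u' : 'I_m -> V')
    n (v : 'I_n -> V) :
    (forall B, positive_relation u B <-> positive_relation u' B) ->
    positive_relation u setT -> independent v -> (forall j, spans u (v j)) ->
  exists v' : 'I_n -> V', independent v'.
Proof.
move=> uu' uT iv vu.
have [W relW] := relation_space u; have [W' relW'] := relation_space u'.
have supp (U : {vspace 'rV[F]_m}) (X : lmodType F) (x : 'I_m -> X) B :
    (forall w, w \in U <-> \sum_i w 0 i *: x i = 0) ->
    positive_support U B <-> positive_relation x B.
  by move=> relU; split=> -[w /relU]; exists w.
have eqdim : \dim W = \dim W'.
  apply: eq_dim_positive_supports => [B|]; last exact/(supp _ _ _ _ relW).
  by rewrite (supp _ _ _ _ relW) (supp _ _ _ _ relW').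
have /(independent_in_span n relW) : exists2 v : 'I_n -> V, independent v &
  forall j, spans u (v j) by exists v.
by rewrite eqdim => /(independent_in_span n relW')[v' iv' _]; exists v'.
Qed.

End Relations.

(** * The tensor product with the rational numbers *)

Section TensorQ.
Variable A : zmodType.
Local Open Scope quotient_scope.
Local Notation V := (tensor A rat^o).

Definition tens (q : rat) (a : A) : V := \pi_V (pure a (q : rat^o)).

Lemma scale_tens r a q : r *: tens q a = tens (r * q) a.
Proof. by rewrite /tens -[LHS]/(tensor_scale _ _) tensor_scale_pi free_scaleE. Qed.

Lemma tens_add a b q : tens q (a + b) = tens q a + tens q b.
Proof.
by rewrite /tens -raddfD; apply/pi_tensorP; exact: tensor_rel_addl.
Qed.

Lemma tens_is_zmod_morphism q : zmod_morphism (tens q).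
Proof. by move=> a b; apply: (addIr (tens q b)); rewrite -tens_add !subrK. Qed.

HB.instance Definition _ q := GRing.isZmodMorphism.Build A V (tens q)
  (tens_is_zmod_morphism q).

(** Since [a (x) q = q (a (x) 1)], generators of the group give a spanning family
    of the vector space. *)
Lemma tens_span (X : Type) (c : X -> A) :
    (forall a, exists s : seq X, a = \sum_(x <- s) c x) ->
  forall v : V, exists s : seq (rat * X), v = \sum_(p <- s) p.1 *: tens 1 (c p.2).
Proof.
move=> spanc v.
pose P (v : V) := exists s : seq (rat * X), v = \sum_(p <- s) p.1 *: tens 1 (c p.2).
have P0 : P 0 by exists [::]; rewrite big_nil.
have PD x y : P x -> P y -> P (x + y).
  by move=> [s ->] [t ->]; exists (s ++ t); rewrite big_cat.
have PZ r x : P x -> P (r *: x).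
  move=> [s ->]; exists [seq (r * p.1, p.2) | p <- s].
  by rewrite big_map scaler_sumr; apply: eq_bigr => p _; rewrite scalerA.
elim/quotW: v => x; elim/free_ind: x => [|x y Px Py|a q].
- by rewrite raddf0.
- by rewrite raddfB -scaleN1r; apply: PD => //; exact: PZ.
rewrite -[\pi_V _]/(tens q a) -[q]mulr1 -scale_tens; apply: PZ.
have [s ->] := spanc a; rewrite (raddf_sum (tens 1)).
elim: s => [|y s IH]; first by rewrite big_nil.
by rewrite big_cons; apply: PD => //; exists [:: (1, y)]; rewrite big_seq1 scale1r.
Qed.

(** For a fixed [M] the map [a (x) q |-> (M q) a] makes sense only when the
    denominator of [q] divides [M]. Here it is extended to the free group by the
    junk value [numq (M q)], so it kills a given tensor relation only when [M]
    is sufficiently divisible. *)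
Definition clear_denominators (M : nat) : {freeg (A * rat^o)} -> zmodule A :=
  fglift (fun p : A * rat^o => (p.1 *~ numq (M%:R * (p.2 : rat)) : zmodule A)).

Lemma clear_denominatorsB M : zmod_morphism (clear_denominators M).
Proof. exact: lift_is_additive. Qed.

HB.instance Definition _ M := GRing.isZmodMorphism.Build _ _
  (clear_denominators M) (clear_denominatorsB M).

Lemma clear_denominatorsE M a (q : rat) :
  clear_denominators M (pure a (q : rat^o)) = a *~ numq (M%:R * q).
Proof. by rewrite /clear_denominators liftU scale1r. Qed.

(** A tensor relation is built from finitely many bilinearity relations, and [N]
    is a common multiple of the denominators that occur in these. *)
Lemma clear_denominators_eventually0 x : tensor_rel x ->
  exists2 N : nat, (0 < N)%N &
    forall k, (0 < k)%N -> clear_denominators (k * N) x = 0.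
Proof.
elim=> [|{}x y _ [N N0 x0] _ [M M0 y0]|a a' q|a q r].
- by exists 1%N => // k _; rewrite raddf0.
- exists (M * N)%N => [|k k0]; first by rewrite muln_gt0 M0.
  rewrite raddfB /= mulnA x0 ?muln_gt0 ?k0 // mulnAC y0 ?subrr //.
  by rewrite muln_gt0 k0.
- exists 1%N => // k _.
  by rewrite raddfB raddfD /= !clear_denominatorsE mulrzDl subrr.
have clearE (k : nat) (s : rat) : exists z : int, (k * `|denq s|)%:R * s = z%:~R.
  exists (k%:Z * numq s); rewrite natrM -mulrA intrM; congr (_ * _).
  by rewrite (pmulrn 1) absz_denq mulrC -numqE.
exists (`|denq q| * `|denq r|)%N => [|k k0].
  by rewrite muln_gt0 !absz_gt0 !denq_eq0.
rewrite raddfB raddfD /= !clear_denominatorsE mulrDr.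
have [z ->] : exists z : int, (k * (`|denq q| * `|denq r|))%:R * q = z%:~R.
  by rewrite mulnA mulnAC; exact: clearE.
have [t ->] : exists z : int, (k * (`|denq q| * `|denq r|))%:R * r = z%:~R.
  by rewrite mulnA; exact: clearE.
by rewrite -intrD !numq_int mulrzDr subrr.
Qed.

(** The kernel of [A -> A (x) Q] is the torsion of [A]: apply
    [clear_denominators N] to [a (x) 1] for a suitable [N]. *)
Lemma tens1_eq0 a : tens 1 a = 0 -> exists2 N : nat, (0 < N)%N & a *+ N = 0.
Proof.
rewrite -[RHS](raddf0 \pi_V) => /pi_tensorP; rewrite subr0.
move=> /clear_denominators_eventually0[N N0 /(_ 1%N isT)].
by rewrite mul1n clear_denominatorsE mulr1 (pmulrn 1) numq_int => aN; exists N.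
Qed.

(** From right to left the coefficients are the same. From left to right, multiply
    by a common denominator to get natural coefficients, then by an integer that
    kills the resulting torsion element; neither step changes the support. *)
Lemma positive_relation_tens m (c : 'I_m -> A) B :
  positive_relation (fun i => tens 1 (c i)) B <->
  exists2 k : 'I_m -> nat, \sum_i c i *+ k i = 0 & forall i, (0 < k i)%N = (i \in B).
Proof.
have tensE (k : 'I_m -> nat) :
    \sum_i (k i)%:R *: tens 1 (c i) = tens 1 (\sum_i c i *+ k i).
  by rewrite raddf_sum; apply: eq_bigr => i _; rewrite raddfMn scaler_nat.
split=> [[w w0 /forallP wB]|[k k0 kB]]; last first.
  exists (\row_i (k i)%:R).
    under eq_bigr => i _ do rewrite mxE.
    by rewrite tensE k0 raddf0.
  by apply/forallP => i; rewrite -kB mxE ltr0n pnatr_eq0 lt0n; case: eqP.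
pose N := (\prod_i `|denq (w ord0 i)|)%N.
have N0 : (0 < N)%N by apply: prodn_gt0 => i; rewrite absz_gt0 denq_eq0.
have /choice[k kE] : forall i, exists k : nat, N%:R * w 0 i = k%:R.
  move=> i.
  have wi : 0 <= w 0 i by have := wB i; case: ifP => [_ /ltW|_ /eqP ->].
  exists ((\prod_(j | j != i) `|denq (w ord0 j)|) * `|numq (w ord0 i)|)%N.
  rewrite /N (bigD1 i) //= mulnC !natrM -mulrA; congr (_ * _).
  rewrite (pmulrn 1) absz_denq mulrC -numqE (pmulrn 1) gez0_abs //.
  by rewrite numq_ge0.
have [|M M0] := @tens1_eq0 (\sum_i c i *+ k i).
  rewrite -tensE; under eq_bigr => i _ do rewrite -kE -scalerA.
  by rewrite -scaler_sumr w0 scaler0.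
rewrite -sumrMnl => kM; exists (fun i => (k i * M)%N).
  by rewrite -[RHS]kM; apply: eq_bigr => i _; rewrite mulrnA.
move=> i; rewrite muln_gt0 M0 andbT -(ltr0n rat) -kE pmulr_rgt0 ?ltr0n //.
by have := wB i; case: (i \in B) => [-> //|/eqP ->]; rewrite ltxx.
Qed.

End TensorQ.

(** * Ideals of a Dedekind domain *)

Section Factorization.
Variable D : dedekindType.
Local Notation K := {fraction D}.
Implicit Types (x y a : D).

Definition primes : set (set D) :=
  [set P | prime_ideal P /\ exists2 x, x != 0 & P x].

Implicit Types P Q : primes.

Lemma primeP P : prime_ideal (\val P).
Proof. by case: (set_valP P). Qed.

(** Distinct nonzero primes are incomparable, as the Krull dimension is one. *)
Lemma prime_sub_eq P Q : \val P `<=` \val Q -> P = Q.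
Proof.
move=> PQ; have [pP [x x0 Px]] := set_valP P; apply: val_inj.
exact: krull_dim1_prime_eq (@dedekind_krull_dim1 D) pP (primeP Q) x0 Px PQ.
Qed.

Lemma prime_exp P x n : \val P (x ^+ n) -> \val P x.
Proof.
have [_ P1 Pm] := primeP P.
by elim: n => [|n IH]; rewrite ?expr0 // exprS => /Pm[|/IH].
Qed.

Definition extension (I : set D) : set K := [set z | exists2 a, I a & z = a%:F].

Lemma extensionE (I : set D) a : extension I a%:F <-> I a.
Proof. by split=> [[b Ib /eqP]|Ia]; [rewrite tofrac_eq => /eqP -> | exists a]. Qed.

Lemma extension_nonzero_fractional (I : set D) : ideal I -> (exists2 x, x != 0 & I x) ->
  nonzero_fractional (extension I).
Proof.
move=> [I0 ID IM] [x x0 Ix]; split; last by exists x%:F; rewrite ?tofrac_eq0 //; exists x.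
split.
- by exists 0; rewrite ?tofrac0.
- by move=> _ _ [a Ia ->] [b Ib ->]; exists (a + b); [exact: ID | rewrite rmorphD].
- by move=> a _ [b Ib ->]; exists (a * b); [exact: IM | rewrite rmorphM].
- by exists 1; rewrite ?oner_neq0 // => _ [a _ ->]; exists a; rewrite tofrac1 mul1r.
Qed.

Definition prime_frac P : frac_ideals D :=
  FracIdeal (extension_nonzero_fractional (let: And3 idP _ _ := primeP P in idP)
                                          (proj2 (set_valP P))).

(** A maximal proper ideal above [I] exists by noetherianity, and is prime: if it
    misses [x], then [1] is of the form [p + r * x] with [p] in the ideal. *)
Lemma mem_maximal_ideal (I : set D) : ideal I -> (exists2 x, x != 0 & I x) -> ~ I 1 ->
  exists P, I `<=` \val P.
Proof.
move=> idI [c c0 Ic] I1; pose F := [set J | [/\ ideal J, I `<=` J & ~ J 1]].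
have FI : F I by split.
have [J [] //|P [idP IP P1] Pmax] := noetherian_max (@dedekind_noetherian D) FI.
have [P0 PD PM] := idP.
have Padd x : ~ P x -> exists p r, P p /\ 1 = p + r * x.
  move=> nPx; pose Q := [set y | exists p r, P p /\ y = p + r * x].
  have PQ : P `<=` Q by move=> y Py; exists y, 0; rewrite mul0r addr0.
  apply: contrapT => nQ1; apply: nPx; rewrite -(Pmax Q) => //.
    by exists 0, 1; rewrite add0r mul1r.
  split=> //; last by move=> y /IP /PQ.
  split; first exact: PQ.
  - move=> _ _ [p [r [Pp ->]]] [q [s [Pq ->]]]; exists (p + q), (r + s).
    by split; [exact: PD | rewrite mulrDl addrACA].
  - move=> u _ [p [r [Pp ->]]]; exists (u * p), (u * r).
    by split; [exact: PM | rewrite mulrDr mulrA].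
have pP : prime_ideal P.
  split=> // x y Pxy; apply: contrapT => /not_orP[/Padd[p [r [Pp e]]] nPy].
  apply: nPy; have -> : y = y * p + r * (x * y).
    by rewrite -[LHS]mul1r e mulrDl (mulrC p) mulrA.
  by apply: PD; exact: PM.
have nzP : primes P by split=> //; exists c => //; exact: IP.
by exists (exist _ P (mem_set nzP)).
Qed.

Definition integral_frac (I : frac_ideals D) : Prop :=
  forall z, \val I z -> exists a : D, z = a%:F.

Lemma val_oppP (I : frac_ideals D) : \val (- I) = inv_frac (\val I).
Proof. by []. Qed.

Lemma val_add_min (I J M : frac_ideals D) :
    (forall x y : K, \val I x -> \val J y -> \val M (x * y)) ->
  \val (I + J) `<=` \val M.
Proof. by move=> IJM; apply: mul_frac_sub IJM; case: (set_valP M). Qed.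

Lemma contraction_ideal (I : frac_ideals D) : ideal [set a | \val I a%:F].
Proof.
have [[I0 ID IM _] _] := set_valP I.
split=> /= [|a b Ia Ib|a b Ib]; first by rewrite tofrac0.
  by rewrite rmorphD; exact: ID.
by rewrite rmorphM; exact: IM.
Qed.

Lemma contraction_nonzero (I : frac_ideals D) : integral_frac I ->
  exists2 x, x != 0 & \val I x%:F.
Proof.
move=> intI; have [_ [z z0 Iz]] := set_valP I; have [a za] := intI _ Iz.
by exists a; [rewrite -tofrac_eq0 -za | rewrite -za].
Qed.

Lemma extension_contraction (I : frac_ideals D) : integral_frac I ->
  extension [set a | \val I a%:F] = \val I.
Proof.
move=> intI; apply/seteqP; split=> [_ [a Ia ->] //|z Iz].
by have [a za] := intI _ Iz; exists a; rewrite /= -?za.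
Qed.

Lemma val_zeroP z : \val (0 : frac_ideals D) z <-> exists a : D, z = a%:F.
Proof. by split=> [[a ->]|[a ->]]; exists a; rewrite mulr1. Qed.

Lemma integral_frac_add (I J : frac_ideals D) :
  integral_frac I -> integral_frac J -> integral_frac (I + J).
Proof.
move=> intI intJ z; suff sub0 : \val (I + J) `<=` \val (0 : frac_ideals D).
  by move=> /sub0 /val_zeroP.
apply: val_add_min => _ _ /intI[a ->] /intJ[b ->]; apply/val_zeroP.
by exists (a * b); rewrite rmorphM.
Qed.

(** A maximal counterexample [M] is proper, so lies in a nonzero prime [P], and
    [M P^-1] is an integral ideal that contains [M]. As [P] is not the unit ideal,
    it is strictly larger because fractional ideals form a group; hence it is a
    product of primes, and so is [M]. *)
Lemma factorization (I : frac_ideals D) : integral_frac I ->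
  exists s : seq primes, I = \sum_(P <- s) prime_frac P.
Proof.
move=> intI; apply: contrapT => noI.
pose F := [set J : set D | exists M : frac_ideals D,
  [/\ J = [set a | \val M a%:F], integral_frac M &
      ~ exists s : seq primes, M = \sum_(P <- s) prime_frac P]].
have FI : F [set a | \val I a%:F] by exists I.
have [J [M [-> _ _]]|_ [M [-> intM noM]] maxM] :=
  noetherian_max (@dedekind_noetherian D) FI; first exact: contraction_ideal.
have [|P MP] := mem_maximal_ideal (contraction_ideal M) (contraction_nonzero intM).
  move=> /= M1; apply: noM; exists [::]; rewrite big_nil; apply: val_inj.
  apply/seteqP; split=> z; first by move=> /intM /val_zeroP.
  move=> /val_zeroP[a ->]; rewrite -[a]mulr1.
  by have [_ _] := contraction_ideal M; apply.
pose N := M - prime_frac P.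
have MN : \val M `<=` \val N.
  have P1 : \val (- prime_frac P) 1.
    by rewrite val_oppP => _ [a _ ->]; exists a; rewrite mul1r.
  by move=> z Mz; rewrite -[z]mulr1; exact: mul_frac_mem.
have intN : integral_frac N.
  have sub0 : \val N `<=` \val (0 : frac_ideals D).
    apply: val_add_min => x y Mx Py; apply/val_zeroP.
    have [a xa] := intM _ Mx; have Pa : \val P a by apply: MP; rewrite /= -xa.
    by rewrite mulrC xa; move: Py; rewrite val_oppP; apply; exists a.
  by move=> z /sub0 /val_zeroP.
have [s Ns] : exists s : seq primes, N = \sum_(P <- s) prime_frac P.
  apply: contrapT => noN.
  have NM : [set a | \val N a%:F] = [set a | \val M a%:F].
    by apply: maxM => [|a]; [exists N | exact: MN].
  have /eqP : N = M.
    by apply: val_inj; rewrite -(extension_contraction intN) NM (extension_contraction intM).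
  rewrite -subr_eq0 /N addrAC subrr sub0r oppr_eq0 => /eqP P0.
  have : \val (prime_frac P) 1 by rewrite P0; apply/val_zeroP; exists 1; rewrite tofrac1.
  by rewrite -(tofrac1 D) => /extensionE; case: (primeP P).
by apply: noM; exists (P :: s); rewrite big_cons -Ns /N addrC subrK.
Qed.

Lemma integral_frac_prime P : integral_frac (prime_frac P).
Proof. by move=> _ [a _ ->]; exists a. Qed.

Lemma integral_frac_sum (s : seq primes) :
  integral_frac (\sum_(P <- s) prime_frac P).
Proof.
elim/big_ind: _ => [z /val_zeroP //||P _]; first exact: integral_frac_add.
exact: integral_frac_prime.
Qed.

Lemma val_sum_sub (s : seq primes) Q : Q \in s ->
  \val (\sum_(P <- s) prime_frac P) `<=` \val (prime_frac Q).
Proof.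
move=> Qs; rewrite (perm_big _ (perm_to_rem Qs)) big_cons.
have [_ _ QM] : ideal (\val Q) by case: (primeP Q).
apply: val_add_min => _ _ [a Qa ->] /integral_frac_sum[b ->].
by exists (a * b); [rewrite mulrC; exact: QM | rewrite rmorphM].
Qed.

(** A prime that contains a product of primes contains one of them, hence is
    equal to it. *)
Lemma mem_of_sum_sub (s : seq primes) Q :
    (forall a, \val (\sum_(P <- s) prime_frac P) a%:F -> \val Q a) ->
  Q \in s.
Proof.
have [_ Q1 Qm] := primeP Q; elim: s => [|P s IH] sQ.
  case: Q1; apply: sQ; rewrite big_nil; apply/val_zeroP; by exists 1.
rewrite inE; have [//|PQ /=] := eqVneq Q P; apply: IH => b sb.
have [p Pp nQp] : exists2 p, \val P p & ~ \val Q p.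
  apply: contrapT => noP; case/eqP: PQ; apply/esym/prime_sub_eq => p Pp.
  by apply: contrapT => nQp; apply: noP; exists p.
have /sQ/Qm[] // : \val (\sum_(P <- P :: s) prime_frac P) (p * b)%:F.
by rewrite big_cons rmorphM; apply: mul_frac_mem => //; exists p.
Qed.

Lemma sum_prime_exp (s : seq primes) x : (forall P, P \in s -> \val P x) ->
  \val (\sum_(P <- s) prime_frac P) (x ^+ size s)%:F.
Proof.
elim: s => [|P s IH] sx; first by rewrite big_nil; apply/val_zeroP; exists 1.
rewrite big_cons exprS rmorphM; apply: mul_frac_mem.
  by exists x => //; apply: sx; rewrite mem_head.
by apply: IH => Q Qs; apply: sx; rewrite inE Qs orbT.
Qed.

Lemma tofrac_neq0 x : x != 0 -> x%:F != 0 :> K.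
Proof. by rewrite tofrac_eq0. Qed.

Definition principal_frac x (x0 : x != 0) : frac_ideals D :=
  FracIdeal (principal_nonzero_fractional (tofrac_neq0 x0)).

Lemma principal_fracE x (x0 : x != 0) a :
  \val (principal_frac x0) a%:F <-> exists b, a = b * x.
Proof.
split=> [[b /eqP]|[b ->]]; first by rewrite -rmorphM tofrac_eq => /eqP ->; exists b.
by exists b; rewrite rmorphM.
Qed.

Lemma integral_principal_frac x (x0 : x != 0) : integral_frac (principal_frac x0).
Proof. by move=> _ [b ->]; exists (b * x); rewrite rmorphM. Qed.

(** This describes the primes that contain [x] and shows that there are finitely
    many of them. *)
Lemma mem_principal_factors x (x0 : x != 0) (s : seq primes) Q :
  principal_frac x0 = \sum_(P <- s) prime_frac P -> \val Q x <-> Q \in s.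
Proof.
have [[_ _ QM] _ _] := primeP Q; move=> xs; split=> [Qx|Qs].
  apply: mem_of_sum_sub => a; rewrite -xs => /principal_fracE[b ->]; exact: QM.
have /(val_sum_sub Qs) : \val (\sum_(P <- s) prime_frac P) x%:F.
  by rewrite -xs; apply/principal_fracE; exists 1; rewrite mul1r.
by move=> /extensionE.
Qed.

(** If each prime containing [y] contains [x], then [x ^+ n] is in the product of
    the [n] prime factors of [y], which is the ideal generated by [y]. *)
Lemma radical_subP x y : x != 0 -> y != 0 ->
  radical (principal_ideal x) `<=` radical (principal_ideal y) <->
  forall P, \val P y -> \val P x.
Proof.
move=> x0 y0; split=> [xy P Py|yx].
  have [n [a xn]] : radical (principal_ideal y) x.
    by apply: xy; exists 1%N, 1; rewrite expr1 mul1r.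
  have [[_ _ PM] _ _] := primeP P.
  by apply: (@prime_exp _ _ n); rewrite xn; exact: PM.
have [s ys] := factorization (@integral_principal_frac _ y0).
have /sum_prime_exp : forall P, P \in s -> \val P x.
  by move=> P /(mem_principal_factors P ys) /yx.
rewrite -ys => /principal_fracE[a xa] z [n [b zn]].
exists (n * size s)%N, (b ^+ size s * a).
by rewrite exprM zn exprMn xa mulrA.
Qed.

Definition ideal_class (I : frac_ideals D) : Cl D :=
  \pi_(Quotient.quot (@principal_ideals D))%qT I.

Lemma ideal_class_is_zmod_morphism : zmod_morphism ideal_class.
Proof. by move=> I J; rewrite /ideal_class raddfB. Qed.

HB.instance Definition _ := GRing.isZmodMorphism.Build (frac_ideals D) (Cl D)
  ideal_class ideal_class_is_zmod_morphism.

Lemma ideal_class_eq0 (I : frac_ideals D) : ideal_class I = 0 <->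
  exists2 x : K, x != 0 & \val I = principal_fractional x.
Proof.
rewrite -(raddf0 ideal_class); split=> [/eqP|I0].
  by rewrite -Quotient.idealrBE subr0 => /asboolP.
by apply/eqP; rewrite -Quotient.idealrBE subr0; apply/asboolP.
Qed.

Definition prime_class P : Cl D := ideal_class (prime_frac P).

(** Every fractional ideal becomes integral after multiplication by a principal
    ideal, and then factors into primes. *)
Lemma prime_class_gen (a : Cl D) :
  exists s : seq primes, a = \sum_(P <- s) prime_class P.
Proof.
elim/quotW: a => I.
have [[_ _ _ [d d0 dI]] _] := set_valP I.
have [z|s Is] := @factorization (principal_frac d0 + I).
  suff /(_ z) H : \val (principal_frac d0 + I) `<=` \val (0 : frac_ideals D).
    by move/H/val_zeroP.
  apply: val_add_min => _ y [a ->] /dI[b yb]; apply/val_zeroP.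
  by exists (a * b); rewrite -mulrA yb rmorphM.
exists s; rewrite -[LHS]/(ideal_class I).
have d_0 : ideal_class (principal_frac d0) = 0.
  by apply/ideal_class_eq0; exists d%:F; rewrite ?tofrac_neq0.
have -> : ideal_class I = ideal_class (principal_frac d0 + I).
  by rewrite raddfD /= d_0 add0r.
by rewrite Is raddf_sum.
Qed.

(** A relation with natural coefficients [k] says that the product of the powers
    [P i ^ k i] is principal; a generator of it lies in exactly the primes [P i]
    with [0 < k i]. Conversely [k i] is the multiplicity of [P i] in the
    factorization of [x]. *)
Lemma prime_relation_principal m (P : 'I_m -> primes) (B : {set 'I_m}) : injective P ->
  (exists2 k : 'I_m -> nat,
     \sum_i prime_class (P i) *+ k i = 0 & forall i, (0 < k i)%N = (i \in B)) <->
  exists2 x, x != 0 & forall Q, \val Q x <-> exists2 i, i \in B & Q = P i.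
Proof.
move=> injP; split=> [[k k0 kB]|[x x0 xB]].
  pose s := flatten [seq nseq (k i) (P i) | i <- index_enum 'I_m].
  have memsP Q : reflect (exists2 i, i \in B & Q = P i) (Q \in s).
    apply: (iffP flatten_mapP) => [[i _]|[i iB ->]].
      by rewrite mem_nseq kB => /andP[iB /eqP ->]; exists i.
    by exists i; rewrite ?mem_index_enum // mem_nseq kB iB eqxx.
  have sE : \sum_(Q <- s) prime_frac Q = \sum_i prime_frac (P i) *+ k i.
    rewrite big_flatten big_map; apply: eq_bigr => i _.
    by rewrite big_nseq iter_addr addr0.
  have [x x0 sx] : exists2 x : K, x != 0 &
      \val (\sum_(Q <- s) prime_frac Q) = principal_fractional x.
    apply/ideal_class_eq0; rewrite sE raddf_sum -[RHS]k0.
    by apply: eq_bigr => i _; rewrite raddfMn.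
  have [|a xa] := @integral_frac_sum s x.
    by rewrite sx; exists 1; rewrite tofrac1 mul1r.
  have a0 : a != 0 by rewrite -tofrac_eq0 -xa.
  exists a => // Q; have as_ : principal_frac a0 = \sum_(Q <- s) prime_frac Q.
    by apply: val_inj; rewrite sx xa.
  by split=> [/(mem_principal_factors Q as_)/memsP|/memsP/(mem_principal_factors Q as_)].
have [s xs] := factorization (@integral_principal_frac _ x0).
have sB Q : Q \in s -> exists2 i, i \in B & Q = P i.
  by move=> /(mem_principal_factors Q xs) /xB.
exists (fun i => count_mem (P i) s); last first.
  move=> i; rewrite -has_count has_pred1.
  apply/idP/idP => [/sB[j jB /injP -> //]|iB].
  by apply/(mem_principal_factors _ xs)/xB; exists i.
have : ideal_class (principal_frac x0) = 0.
  by apply/ideal_class_eq0; exists x%:F; rewrite ?tofrac_neq0.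
rewrite xs raddf_sum => s0; rewrite -[RHS]s0 {s0} -/(prime_class _).
elim: s {xs} sB => [|Q s IH] sB; first by rewrite big_nil big1.
rewrite big_cons -IH => [|R Rs]; last by apply: sB; rewrite inE Rs orbT.
have [i _ ->] := sB Q (mem_head _ _).
under eq_bigr => j _ do rewrite /= mulrnDr.
rewrite big_split /=; congr (_ + _).
rewrite (bigD1 i) //= eqxx mulr1n big1 ?addr0 // => j ji.
by rewrite (inj_eq injP) eq_sym (negPf ji).
Qed.

End Factorization.

Arguments primes D : clear implicits.

(** * Recovering the primes from the principal radicals *)

(** An isomorphism of the posets of principal radicals, seen on generators. As a
    relation it is symmetric in [D] and [D'], and inclusion of radicals is
    replaced by inclusion of the sets of primes through [radical_subP]. *)
Definition radical_correspondence (D D' : dedekindType) (r : D -> D' -> Prop) :=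
  [/\ forall x x', r x x' -> x != 0 /\ x' != 0,
      forall x, x != 0 -> exists x', r x x',
      forall x', x' != 0 -> exists x, r x x' &
      forall x x' y y', r x x' -> r y y' ->
        (forall P : primes D, \val P y -> \val P x) <->
        (forall Q : primes D', \val Q y' -> \val Q x')].

Lemma radical_correspondence_sym (D D' : dedekindType) (r : D -> D' -> Prop) :
  radical_correspondence r -> radical_correspondence (fun x' x => r x x').
Proof.
move=> [r0 rl rr rE]; split=> // [x' x /r0[]|x' x y' y rx ry] //.
by rewrite (rE _ _ _ _ rx ry).
Qed.

Lemma order_isomorphic_radical (D D' : dedekindType) :
    order_isomorphic (principal_radicals D) (principal_radicals D') ->
  exists r : D -> D' -> Prop, radical_correspondence r.
Proof.
move=> [f [g fK gK] fE].
have memI T (A : set T) y : A y -> exists I : A, \val I = y.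
  by move=> Ay; exists (exist (fun z => z \in A) y (mem_set Ay)).
exists (fun x x' => [/\ x != 0, x' != 0 & exists I : principal_radicals D,
  \val I = radical (principal_ideal x) /\
  \val (f I) = radical (principal_ideal x')]).
split=> [x x' [] //|x x0|x' x'0|x x' y y' [x0 x'0 [I [Ix Ix']]] [y0 y'0 [J [Jy Jy']]]].
- have [I Ix] : exists I : principal_radicals D, \val I = radical (principal_ideal x).
    by apply: memI; exists x.
  by have [x' x'0 fI] := set_valP (f I); exists x'; split=> //; exists I.
- have [I Ix'] : exists I : principal_radicals D', \val I = radical (principal_ideal x').
    by apply: memI; exists x'.
  have [x x0 gI] := set_valP (g I); exists x; split=> //; exists (g I).
  by rewrite gK.
by rewrite -!radical_subP // -Ix -Jy -Ix' -Jy'.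
Qed.

Section Matching.
Variables (D D' : dedekindType) (r : D -> D' -> Prop).
Hypothesis rP : radical_correspondence r.

Definition matching (P : primes D) (Q : primes D') : Prop :=
  forall x x', r x x' -> \val P x <-> \val Q x'.

(** The elements matched with those outside [P] have a common missed prime.
    Otherwise every prime [Q] of [D'] contains some [w'] whose partner [w] is not
    in [P]. Let [p'] be the partner of a nonzero [p] in [P]. The product [y] of
    the elements [w] chosen for the finitely many [Q] containing [p'] is outside
    [P], but its partner lies in every prime containing [p'], so [y] lies in
    every prime containing [p], in particular in [P]. *)
Lemma prime_contracts (P : primes D) :
  exists Q : primes D', forall x x', r x x' -> \val Q x' -> \val P x.
Proof.
have [r0 rl rr rE] := rP; apply: contrapT => noQ.
have [_ P1 Pm] := primeP P.
have avoid (Q : primes D') : exists w w', [/\ r w w', \val Q w' & ~ \val P w].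
  apply: contrapT => now; apply: noQ; exists Q => x x' rx Qx'.
  by apply: contrapT => nPx; apply: now; exists x, x'.
have avoid_seq (s : seq (primes D')) :
    exists y y', [/\ r y y', ~ \val P y & forall Q, Q \in s -> \val Q y'].
  elim: s => [|Q s [y [y' [ry nPy ys]]]].
    by have [y' ry] := rl 1 (oner_neq0 _); exists 1, y'.
  have [w [w' [rw Qw' nPw]]] := avoid Q.
  have [y0 _] := r0 _ _ ry; have [w0 _] := r0 _ _ rw.
  have [z' rz] := rl (y * w) (mulf_neq0 y0 w0).
  exists (y * w), z'; split=> //; first by move=> /Pm[].
  have yz : forall R : primes D', \val R y' -> \val R z'.
    apply/(rE _ _ _ _ rz ry) => R Ry; rewrite mulrC.
    by have [[_ _ RM] _ _] := primeP R; exact: RM.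
  have wz : forall R : primes D', \val R w' -> \val R z'.
    apply/(rE _ _ _ _ rz rw) => R Rw.
    by have [[_ _ RM] _ _] := primeP R; exact: RM.
  by move=> R; rewrite inE => /orP[/eqP -> |/ys]; [exact: wz | exact: yz].
have [_ [p p0 Pp]] := set_valP P; have [p' rp] := rl p p0.
have [_ p'0] := r0 _ _ rp.
have [s ps] := factorization (@integral_principal_frac _ _ p'0).
have [y [y' [ry nPy ys]]] := avoid_seq s; apply: nPy.
move: P Pp {noQ P1 Pm avoid avoid_seq}; apply/(rE _ _ _ _ ry rp) => Q.
by move=> /(mem_principal_factors Q ps) /ys.
Qed.

Lemma matching_uniq P Q1 Q2 : matching P Q1 -> matching P Q2 -> Q1 = Q2.
Proof.
have [_ _ rr _] := rP; move=> m1 m2; apply: prime_sub_eq => x' Qx'.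
have [->|/rr[x rx]] := eqVneq x' 0; first by case: (primeP Q2) => -[].
by apply/(m2 _ _ rx)/(m1 _ _ rx).
Qed.

End Matching.

Lemma matching_sym (D D' : dedekindType) (r : D -> D' -> Prop) P Q :
  matching r P Q -> matching (fun x' x => r x x') Q P.
Proof. by move=> m x' x rx; rewrite (m _ _ rx). Qed.

(** Going to [D'] and back gives a prime [P2] contained in [P], hence equal to
    [P], so the two implications combine into an equivalence. *)
Lemma matching_exists (D D' : dedekindType) (r : D -> D' -> Prop) (P : primes D) :
  radical_correspondence r -> exists Q, matching r P Q.
Proof.
move=> rP; have [Q QP] := prime_contracts rP P.
have [P2 P2Q] := prime_contracts (radical_correspondence_sym rP) Q.
have [_ rl _ _] := rP.
have P2P : P2 = P.
  apply: prime_sub_eq => x P2x.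
  have [->|/rl[x' rx]] := eqVneq x 0; first by case: (primeP P) => -[].
  by apply: (QP _ _ rx); exact: (P2Q _ _ rx).
by exists Q => x x' rx; split; [rewrite -P2P; exact: P2Q | exact: QP].
Qed.

Lemma principal_locus_transfer (D D' : dedekindType) (r : D -> D' -> Prop) m
    (P : 'I_m -> primes D) (Q : 'I_m -> primes D') (B : {set 'I_m}) :
    radical_correspondence r -> (forall i, matching r (P i) (Q i)) ->
    (exists2 x, x != 0 & forall R, \val R x <-> exists2 i, i \in B & R = P i) ->
  exists2 x', x' != 0 & forall R, \val R x' <-> exists2 i, i \in B & R = Q i.
Proof.
move=> rP PQ [x x0 xB]; have [r0 rl _ _] := rP; have [x' rx] := rl x x0.
have [_ x'0] := r0 _ _ rx; exists x' => // R; split=> [Rx'|[i iB ->]].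
  have [P0 mP0] := matching_exists R (radical_correspondence_sym rP).
  have /xB[i iB P0i] : \val P0 x by apply/(mP0 _ _ rx).
  exists i => //; apply: (matching_uniq rP) (PQ i); rewrite -P0i.
  exact: matching_sym mP0.
by apply/(PQ i _ _ rx)/xB; exists i.
Qed.

(** Finitely many vectors of [Cl D (x) Q] involve the classes of finitely many
    primes. All of these contain a common [x != 0], and the primes containing
    [x] carry an everywhere positive relation, as [independent_transfer]
    requires. *)
Lemma independent_class_transfer (D D' : dedekindType) (r : D -> D' -> Prop) n :
    radical_correspondence r ->
    (exists v : 'I_n -> tensor (Cl D) rat^o, independent v) ->
  exists v : 'I_n -> tensor (Cl D') rat^o, independent v.
Proof.
move=> rP [v iv].
have /choice[sv vE] (j : 'I_n) := tens_span (@prime_class_gen D) (v j).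
pose L := [seq p.2 | p <- flatten [seq sv j | j <- enum 'I_n]].
have [x x0 Lx] : exists2 x : D, x != 0 & forall P, P \in L -> \val P x.
  elim: L => [|P s [y y0 sy]]; first by exists 1; rewrite ?oner_neq0.
  have [[[_ _ PM] _ _] [z z0 Pz]] := set_valP P.
  exists (y * z) => [|Q]; first by rewrite mulf_neq0.
  rewrite inE => /orP[/eqP ->|/sy Qy]; first exact: PM.
  by rewrite mulrC; have [[_ _ QM] _ _] := primeP Q; exact: QM.
have [s xs] := factorization (@integral_principal_frac _ _ x0).
pose t := in_tuple (undup s).
have injP : injective (tnth t) by apply/tuple_uniqP/undup_uniq.
have memt Q : \val Q x <-> exists2 i, i \in (setT : {set 'I_(size (undup s))}) & Q = tnth t i.
  rewrite (mem_principal_factors Q xs) -mem_undup; split=> [/(@tnthP _ _ t)[i ->]|[i _ ->]].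
    by exists i; rewrite ?inE.
  exact: (mem_tnth i t).
have /choice[P' tP'] (i : 'I_(size (undup s))) := matching_exists (tnth t i) rP.
have rP' := radical_correspondence_sym rP.
have injP' : injective P'.
  move=> i j ij; apply: injP; apply: (matching_uniq rP' (P := P' i)).
    exact/matching_sym/tP'.
  by rewrite ij; exact/matching_sym/tP'.
apply: (@independent_transfer _ _ _ _ (fun i => tens 1 (prime_class (tnth t i)))
  (fun i => tens 1 (prime_class (P' i))) n v) => // [B||j].
- rewrite !positive_relation_tens !prime_relation_principal //.
  split; first exact: (principal_locus_transfer rP tP').
  by apply: (principal_locus_transfer rP') => i; exact/matching_sym/tP'.
- rewrite positive_relation_tens prime_relation_principal //.
  by exists x.
have svL p : p \in sv j -> p.2 \in L.
  move=> pj; apply: map_f; apply/flatten_mapP; exists j => //.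
  by rewrite mem_enum.
rewrite vE; elim: (sv j) svL => [|p w IH] svL.
  by exists (fun=> 0); rewrite big_nil big1 // => i _; rewrite scale0r.
have [|c wc] := IH; first by move=> q qw; apply: svL; rewrite inE qw orbT.
have /memt[i _ pi] : \val p.2 x by apply/Lx/svL; rewrite mem_head.
exists (fun k => (k == i)%:R * p.1 + c k).
rewrite big_cons wc; under [RHS]eq_bigr => k _ do rewrite scalerDl.
rewrite big_split /=; congr (_ + _).
rewrite (bigD1 i) //= eqxx mul1r big1 ?addr0 ?pi // => k /negPf ->.
by rewrite mul0r scale0r.
Qed.

Theorem theorem4p11 (D D' : dedekindType)
    (isoP : order_isomorphic (principal_radicals D) (principal_radicals D')) :
  rk (Cl D) = rk (Cl D').
Proof.
have [r rP] := order_isomorphic_radical isoP; apply: eq_dimension => n.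
by split; apply: independent_class_transfer;
  [exact: rP | exact: radical_correspondence_sym rP].
Qed.
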